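(* Let $\mathcal{H}$ be a complex Hilbert space and let $S\in\mathcal{L}(\mathcal{H})$ have closed range. Suppose that there exists a positive operator $T\in\mathcal{L}(\mathcal{H})$ with $\|T\|\leq 1$, $\mathcal{N}(T)=\mathcal{N}(S)$ and $\mathcal{R}(T)$ closed such that $S=P_ST$. Let $T=P_T-V$ be the projection proper splitting of $T$, let $S=P_SP_T-P_SV$ be the proper splitting of $S$ induced by $T$, and let $S=U_S-W$ be the polar proper splitting of $S$. Then $\rho\big((P_SP_T)^\dagger P_SV\big)\leq\rho(U_S^*W)$.
   Context: $P_S$, $P_T$ are the orthogonal projections onto $\mathcal{R}(S)$, $\mathcal{R}(T)$; $\rho$ is the spectral radius; $A^\dagger$ is the Moore-Penrose inverse of a closed range operator $A$. Positive means self-adjoint and positive semidefinite. A proper splitting of a closed range operator $A$ is a decomposition $A=U-V$ with $\mathcal{R}(U)=\mathcal{R}(A)$ and $\mathcal{N}(U)=\mathcal{N}(A)$. The projection proper splitting of a closed range Hermitian $T$ is $T=P_T-V$, i.e. $V=P_T-T$. The polar proper splitting of a closed range $S$ is $S=U_S-W$, i.e. $W=U_S-S$, where $S=U_S|S|$ is the polar decomposition, $|S|=(S^*S)^{1/2}$, and $U_S$ is the partial isometry with $\mathcal{N}(U_S)=\mathcal{N}(S)$. *)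

(* Defs.v *)
From HB Require Import structures.
From mathcomp Require Import all_boot all_order all_algebra.
From mathcomp Require Import complex.
From mathcomp Require Import all_classical all_reals all_analysis.

Set Implicit Arguments.
Unset Strict Implicit.
Unset Printing Implicit Defensive.

Import Order.TTheory GRing.Theory Num.Theory.
Import numFieldNormedType.Exports.

Local Open Scope classical_set_scope.
Local Open Scope ring_scope.

(* The form is linear in its first argument and conjugate-linear in its second. *)
Record hilbertSpace (R : realType) := HilbertSpace {
  hilbert_carrier :> completeNormedModType R[i] ;
  inner : {dot hilbert_carrier for Num.conj} ;
  hilbert_normE : forall x, `|x| = sqrtC (inner x x) }.

Section Operators.
Variables (R : realType) (H : hilbertSpace R).
Local Notation "''[' x , y ]" := (inner H x y) : ring_scope.
Implicit Types (A B U : H -> H) (M : set H).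

(* The constructions below written with [xget] select an element that exists
   and is unique under the usual hypotheses (bounded A, closed M, A of closed
   range, A positive); outside of them the value is the default. *)

Definition bounded_operator A := linear A /\ continuous A.

(* Norms in H are R[i]-valued, hence the real parts here and in
   [spectral_radius]. *)
Definition opnorm A : R :=
  sup [set complex.Re `|A x| | x in [set x | `|x| <= 1]].

Definition null_space A : set H := [set x | A x = 0].

Definition orthogonal_complement M : set H :=
  [set x | forall y, M y -> '[x, y] = 0].

Definition is_adjoint A B := forall x y, '[A x, y] = '[x, B y].

Definition adjoint A : H -> H :=
  fun y => xget 0 [set z | forall x, '[A x, y] = '[x, z]].

Definition positive_operator A := is_adjoint A A /\ forall x, 0 <= '[A x, x].

(* For a closed subspace M, the orthogonal projection onto M. *)
Definition orthogonal_projection M : H -> H :=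
  fun x => xget 0 [set y | M y /\ orthogonal_complement M (x - y)].

(* For A of closed range: A^dagger y is the unique x in N(A)^perp such that
   A x is the orthogonal projection of y onto R(A). *)
Definition moore_penrose A : H -> H :=
  fun y => xget 0 [set x | orthogonal_complement (null_space A) x /\
                           A x = orthogonal_projection (range A) y].

Definition spectrum A : set R[i] :=
  [set l | ~ exists B, [/\ bounded_operator B,
                           B \o (A \- l \*: id) = id &
                           (A \- l \*: id) \o B = id]].

(* On the zero space the spectrum is empty and this is 0. *)
Definition spectral_radius A : R :=
  sup [set complex.Re `|l| | l in spectrum A].

Definition sqrt_operator A : H -> H :=
  xget (fun=> 0)
    [set B | [/\ bounded_operator B, positive_operator B & B \o B = A]].

Definition abs_operator A : H -> H := sqrt_operator (adjoint A \o A).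

Definition partial_isometry U :=
  bounded_operator U /\
  forall x, orthogonal_complement (null_space U) x -> `|U x| = `|x|.

Definition polar_factor A : H -> H :=
  xget (fun=> 0)
    [set U | [/\ partial_isometry U, null_space U = null_space A &
                 A = U \o abs_operator A]].

End Operators.

(* Main.v *)
(** Both iteration operators are differences with the projection [P_T] onto
    [R(T) = N(S)^perp]: on the left [(P_S P_T)^dagger P_S V = V = P_T - T], and
    on the right [U_S^* W = U_S^* U_S - U_S^* S = P_T - |S|].  Since
    [|S|^2 = T P_S T <= T^2] and the square root is operator monotone,
    [0 <= P_T - T <= P_T - |S|].  For a positive operator [A] the number
    [q = sup <A x, x>] over unit vectors belongs to the spectrum, as there are
    unit vectors with [A x - q x] arbitrarily small, and it bounds the spectrum;
    so the spectral radius is monotone on positive operators. *)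

Require Import Defs.
From HB Require Import structures.
From mathcomp Require Import all_boot all_order all_algebra.
From mathcomp Require Import complex.
From mathcomp Require Import all_classical all_reals all_analysis.
From mathcomp Require Import ring lra.

Import Order.TTheory GRing.Theory Num.Theory.
Import numFieldNormedType.Exports.

Local Open Scope classical_set_scope.
Local Open Scope ring_scope.

(** The constructions in the definitions are choices by [xget], so nothing is known about a
    projection, a modulus or a polar factor until an element of its defining set is exhibited; much
    of the work consists of these existence proofs, all resting on completeness. The identity for
    the left operator holds because P_S is injective on R(T): P_S T w = S w vanishes only when T w
    does, as N(S) = N(T). The bound ||T|| <= 1 enters twice. It gives T <= P_T, and it makes S a
    contraction, so that S^*S <= 1 and the square root iteration applies without rescaling. The
    comparison of squares is used in the form || |S|x || = ||Sx|| <= ||Tx||. *)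

(** * Real-valued inner product and norm *)

Section RealGeometry.
Context {R : realType} {H : hilbertSpace R}.
Implicit Types (x y z : H) (l : R[i]) (a b c : R).

(** Estimates are carried out in [R], where [lra] and [nra] apply; [inner_eq] leads back to the
    complex inner product. *)
Definition re_inner x y : R := complex.Re (inner H x y).
Definition nrm x : R := complex.Re `|x|.

Lemma ReD (u v : R[i]) : complex.Re (u + v) = complex.Re u + complex.Re v.
Proof. by case: u; case: v. Qed.

Lemma ReN (u : R[i]) : complex.Re (- u) = - complex.Re u.
Proof. by case: u. Qed.

Lemma ReMr a (u : R[i]) : complex.Re (a%:C%C * u) = a * complex.Re u.
Proof. by case: u => u v /=; rewrite mul0r subr0. Qed.

Lemma RRe_ge0 (u : R[i]) : 0 <= u -> (complex.Re u)%:C%C = u.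
Proof. by move=> u0; rewrite RRe_real // ger0_real. Qed.

Lemma conjCc (u : R[i]) : Num.conj u = conjc u.
Proof. by []. Qed.

Lemma innerC x y : inner H x y = Num.conj (inner H y x).
Proof. by rewrite (hermC (inner H)) expr0 mul1r. Qed.

Lemma re_innerC x y : re_inner x y = re_inner y x.
Proof. by rewrite /re_inner innerC conjCc; case: (inner H y x). Qed.

Lemma re_innerDl x y z : re_inner (x + y) z = re_inner x z + re_inner y z.
Proof. by rewrite /re_inner linearDl ReD. Qed.

Lemma re_innerNl x z : re_inner (- x) z = - re_inner x z.
Proof. by rewrite /re_inner linearNl ReN. Qed.

Lemma re_innerBl x y z : re_inner (x - y) z = re_inner x z - re_inner y z.
Proof. by rewrite re_innerDl re_innerNl. Qed.

Lemma re_innerZl a x z : re_inner (a%:C%C *: x) z = a * re_inner x z.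
Proof. by rewrite /re_inner linearZl_LR ReMr. Qed.

Lemma re_innerDr x y z : re_inner z (x + y) = re_inner z x + re_inner z y.
Proof. by rewrite re_innerC re_innerDl !(re_innerC z). Qed.

Lemma re_innerNr x z : re_inner z (- x) = - re_inner z x.
Proof. by rewrite re_innerC re_innerNl (re_innerC z). Qed.

Lemma re_innerBr x y z : re_inner z (x - y) = re_inner z x - re_inner z y.
Proof. by rewrite re_innerDr re_innerNr. Qed.

Lemma re_innerZr a x z : re_inner z (a%:C%C *: x) = a * re_inner z x.
Proof. by rewrite re_innerC re_innerZl (re_innerC z). Qed.

Lemma re_inner0l x : re_inner 0 x = 0.
Proof. by rewrite /re_inner linear0l. Qed.

Lemma re_innerJ l x y : re_inner (l *: x) y = re_inner x (conjc l *: y).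
Proof.
rewrite /re_inner linearZl_LR linearZr_LR /=.
by rewrite conjCc conjcK.
Qed.

Lemma normE x : `|x| = (nrm x)%:C%C.
Proof. by rewrite RRe_ge0. Qed.

Lemma nrm_ge0 x : 0 <= nrm x.
Proof. by rewrite -ler0c -normE. Qed.

Lemma inner_normE x : inner H x x = ((nrm x) ^+ 2)%:C%C.
Proof. by rewrite rmorphXn /= -normE hilbert_normE sqrtCK. Qed.

Lemma re_inner_norm x : re_inner x x = nrm x ^+ 2.
Proof. by rewrite /re_inner inner_normE. Qed.

Lemma nrm0 : nrm 0 = 0.
Proof. by rewrite /nrm normr0. Qed.

Lemma nrm_eq0 x : nrm x = 0 -> x = 0.
Proof. by move=> x0; apply/eqP; rewrite -normr_eq0 normE x0. Qed.

Lemma nrmN x : nrm (- x) = nrm x.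
Proof. by rewrite /nrm normrN. Qed.

Lemma nrmD x y : nrm (x + y) <= nrm x + nrm y.
Proof. by rewrite -lecR rmorphD /= -!normE ler_normD. Qed.

Lemma nrmBC x y : nrm (x - y) = nrm (y - x).
Proof. by rewrite -nrmN opprB. Qed.

Lemma nrm_dist x y z : nrm (x - z) <= nrm (x - y) + nrm (y - z).
Proof. by rewrite -{1}(subrK y x) -addrA nrmD. Qed.

Lemma nrmZ l x : nrm (l *: x) = complex.Re `|l| * nrm x.
Proof. by rewrite /nrm normrZ -(RRe_ge0 _ (normr_ge0 l)) ReMr. Qed.

Lemma nrmZr a x : 0 <= a -> nrm (a%:C%C *: x) = a * nrm x.
Proof. by move=> a0; rewrite nrmZ ger0_norm ?ler0c. Qed.

Lemma re_inner_eq0 z : (forall y, re_inner z y = 0) -> z = 0.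
Proof.
by move=> /(_ z); rewrite re_inner_norm => /eqP; rewrite sqrf_eq0 => /eqP /nrm_eq0.
Qed.

(* Turns an additive identity between vectors into one between reals, which [ring] and [lra] solve. *)
Lemma re_inner_ext u v : (forall w, re_inner u w = re_inner v w) -> u = v.
Proof.
move=> h; apply/eqP; rewrite -subr_eq0; apply/eqP/re_inner_eq0 => w.
by rewrite re_innerBl h subrr.
Qed.

(** If d is the difference of the two sides, the hypothesis says that Re (conj l * d) = 0 for every
    l; the choice l = d gives |d|^2 = 0. *)
Lemma inner_eq x y z w :
  (forall l, re_inner x (l *: y) = re_inner z (l *: w)) ->
  inner H x y = inner H z w.
Proof.
move=> h; apply/eqP; rewrite -subr_eq0.
have key l : complex.Re (conjc l * (inner H x y - inner H z w)) = 0.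
  have := h l; rewrite /re_inner !linearZr_LR /= !conjCc => e.
  by rewrite mulrBr ReD ReN e subrr.
set d := _ - _ in key *; rewrite -normr_eq0 -sqrf_eq0 sqr_normc mulrC.
by rewrite -(RRe_ge0 (_ * _)) ?key // mulrC mulcJ_ge0.
Qed.

Lemma inner_eq0 x y : (forall l, re_inner x (l *: y) = 0) -> inner H x y = 0.
Proof.
by move=> h; rewrite (inner_eq x y 0 y) ?linear0l // => l; rewrite h re_inner0l.
Qed.

Lemma parallelogram x y :
  nrm (x + y) ^+ 2 + nrm (x - y) ^+ 2 = 2 * nrm x ^+ 2 + 2 * nrm y ^+ 2.
Proof.
rewrite -!re_inner_norm !(re_innerDl, re_innerDr, re_innerNl, re_innerNr).
by rewrite (re_innerC y x); ring.
Qed.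

Lemma nrmB2 x y : nrm (x - y) ^+ 2 = nrm x ^+ 2 - 2 * re_inner x y + nrm y ^+ 2.
Proof.
rewrite -!re_inner_norm !(re_innerDl, re_innerDr, re_innerNl, re_innerNr).
by rewrite (re_innerC y x); ring.
Qed.

Lemma nrmD2 x y : nrm (x + y) ^+ 2 = nrm x ^+ 2 + 2 * re_inner x y + nrm y ^+ 2.
Proof.
rewrite -!re_inner_norm !(re_innerDl, re_innerDr, re_innerNl, re_innerNr).
by rewrite (re_innerC y x); ring.
Qed.

(** The triangle inequality comes with the norm; squaring and expanding it gives the upper bound,
    and replacing x by -x the lower one. *)
Lemma cauchy_schwarz x y : `|re_inner x y| <= nrm x * nrm y.
Proof.
have lb u v : re_inner u v <= nrm u * nrm v.
  have := nrmD u v; have := nrm_ge0 (u + v).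
  have := nrmD2 u v; have := nrm_ge0 u; have := nrm_ge0 v; nra.
by rewrite ler_norml lb andbT -[nrm x]nrmN lerNl -re_innerNl lb.
Qed.

End RealGeometry.

(** * Completeness, closed sets and bounded linear maps *)

Section Topology.
Context {R : realType} {H : hilbertSpace R}.
Implicit Types (x y z : H) (b c : R[i]) (A B : H -> H) (M : set H).

Lemma gt0_real_complex (l : R[i]) : 0 < l -> 0 < complex.Re l /\ l = (complex.Re l)%:C%C.
Proof. by move=> l0; rewrite RRe_ge0 ?ltW// -ltcR RRe_ge0 ?ltW. Qed.

(** Cantor's intersection principle: nested sets of vanishing diameter generate a Cauchy filter. Its
    limit is only adherent to the sets, as they need not be closed. Minimizers, preimages, iterates
    and the extension of an isometry are all obtained from it. *)
Lemma nrm_cantor (P : R -> H -> Prop) :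
  (forall e, 0 < e -> exists x, P e x) ->
  (forall d e x, d <= e -> P d x -> P e x) ->
  (forall e, 0 < e -> exists2 d, 0 < d &
     forall x y, P d x -> P d y -> nrm (x - y) <= e) ->
  exists l, forall e, 0 < e -> exists2 x, P e x & nrm (x - l) <= e.
Proof.
move=> P0 Pmono Pdiam.
pose F := filter_from [set e : R | 0 < e] (fun e => [set x | P e x]).
have FF : ProperFilter F.
  apply: filter_from_proper; last by move=> e /P0 [x Px]; exists x.
  apply: filter_from_filter; first by exists 1 => /=.
  move=> d e /= d0 e0; exists (Num.min d e); first by rewrite /= lt_min d0.
  by move=> x /= Px; split; apply: Pmono Px; rewrite ge_min lexx ?orbT.
have Fc : cauchy F.
  apply: cauchy_exP => e /gt0_real_complex [e0 ->].
  (* Balls are open, so the diameter is bounded by e / 2 to get a strict inequality. *)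
  have [d d0 Pd] := Pdiam _ (divr_gt0 e0 (ltr0Sn _ 1)).
  have [x Px] := P0 _ d0.
  exists x, d => // y Py; rewrite -ball_normE /= normE ltcR.
  by apply: le_lt_trans (Pd _ _ Px Py) _; rewrite ltr_pdivrMr // ltr_pMr // ltr1n.
have /cvg_ex [l Fl] : cvg F by exact: cauchy_cvg.
exists l => e e0.
have /Fl [d /= d0 Pd] : nbhs l (ball l e%:C%C) by apply: nbhsx_ballx; rewrite ltcR.
have m0 : 0 < Num.min d e by rewrite lt_min d0.
have [x Px] := P0 _ m0; exists x; first by apply: Pmono Px; rewrite ge_min lexx orbT.
have /Pd : P d x by apply: Pmono Px; rewrite ge_min lexx.
by rewrite -ball_normE /= normE ltcR nrmBC => /ltW.
Qed.

Definition approximable M l := forall e, 0 < e -> exists2 x, M x & nrm (x - l) <= e.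

Lemma closed_approximable M l : closed M -> approximable M l -> M l.
Proof.
move=> cM Ml; apply: cM => B /nbhs_ballP [e /gt0_real_complex [e0 ->] eB].
have [x Mx xl] := Ml _ (divr_gt0 e0 (ltr0Sn _ 1)).
exists x; split => //; apply: eB; rewrite -ball_normE /= normE ltcR nrmBC.
by apply: le_lt_trans xl _; rewrite ltr_pdivrMr // ltr_pMr // ltr1n.
Qed.

Section LinearMap.
Variables (A : H -> H) (lA : linear A).

Lemma linP0 : A 0 = 0.
Proof.
have := lA 1 0 0; rewrite !scale1r addr0 => /eqP.
by rewrite -{1}[A 0]addr0 (inj_eq (addrI _)) => /eqP <-.
Qed.

Lemma linPD x y : A (x + y) = A x + A y.
Proof. by rewrite -[x in A (x + y)]scale1r lA scale1r. Qed.

Lemma linPZ c x : A (c *: x) = c *: A x.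
Proof. by rewrite -[c *: x]addr0 lA linP0 addr0. Qed.

Lemma linPN x : A (- x) = - A x.
Proof. by rewrite -scaleN1r linPZ scaleN1r. Qed.

Lemma linPB x y : A (x - y) = A x - A y.
Proof. by rewrite linPD linPN. Qed.

End LinearMap.

Lemma linear_addf A B : linear A -> linear B -> linear (A \+ B).
Proof. by move=> lA lB c x y /=; rewrite lA lB scalerDr addrACA. Qed.

Lemma linear_subf A B : linear A -> linear B -> linear (A \- B).
Proof. by move=> lA lB c x y /=; rewrite lA lB scalerBr opprD addrACA. Qed.

Lemma linear_scalef b A : linear A -> linear (b \*: A).
Proof. by move=> lA c x y /=; rewrite lA scalerDr !scalerA mulrC. Qed.

Lemma linear_comp A B : linear A -> linear B -> linear (A \o B).
Proof. by move=> lA lB c x y /=; rewrite lB lA. Qed.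

Lemma linear_idf : linear (id : H -> H).
Proof. by []. Qed.

Lemma is_adjointP A B : linear B ->
  (forall x y, re_inner (A x) y = re_inner x (B y)) <-> is_adjoint A B.
Proof.
move=> lB; split => [h x y|h x y]; last by rewrite /re_inner h.
by apply: inner_eq => l; rewrite h linPZ.
Qed.

Definition nrm_bounded A := exists2 K, 0 < K & forall x, nrm (A x) <= K * nrm x.

Lemma bounded_operatorP A : linear A -> (bounded_operator A <-> nrm_bounded A).
Proof.
move=> lA; pose lA' := GRing.isLinear.Build _ _ _ _ A lA.
pose A' : {linear H -> H} := HB.pack A lA'.
split => [[_ cA]|[K K0 bA]].
  have /linear_bounded_continuous/linear_boundedP : continuous A' by [].
  move=> [M [Mr bM]]; exists (`|complex.Re M| + 1); first by rewrite ltr_wpDl.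
  move=> x; rewrite -lecR rmorphM /= -!normE; apply: (bM).
  rewrite -(RRe_real Mr) ltcR; apply: le_lt_trans (ler_norm _) _.
  by rewrite ltrDl.
split => //; apply: (bounded_linear_continuous (f := A')).
apply/linear_boundedP; exists K%:C%C; split; first exact/complex_realP/ex_intro.
move=> r Kr x; apply: (@le_trans _ _ (K%:C%C * `|x|)).
  by rewrite !normE -rmorphM /= lecR.
by apply: ler_wpM2r => //; exact: ltW.
Qed.

End Topology.

(** * Orthogonal projections and an invertibility criterion *)

Section Projection.
Context {R : realType} {H : hilbertSpace R}.
Implicit Types (x y z w : H) (c : R[i]) (A B : H -> H) (M : set H).

Definition linear_subspace M :=
  [/\ M 0, forall x y, M x -> M y -> M (x + y) & forall c x, M x -> M (c *: x)].

Lemma linear_subspaceB M x y : linear_subspace M -> M x -> M y -> M (x - y).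
Proof. by case=> _ MD MZ Mx My; rewrite -scaleN1r; apply/MD/MZ. Qed.

Lemma linear_subspace_range A : linear A -> linear_subspace (range A).
Proof.
move=> lA; split.
- by exists 0 => //; exact: linP0.
- by move=> _ _ [x _ <-] [y _ <-]; exists (x + y) => //; exact: linPD.
- by move=> c _ [x _ <-]; exists (c *: x) => //; exact: linPZ.
Qed.

(** Passage to the limit for errors linear in e. [K] may have any sign, hence [|K| + 1] in the
    choice of e. *)
Lemma le_of_le_eps (u v K : R) : (forall e, 0 < e -> u <= v + e * K) -> u <= v.
Proof.
move=> h; rewrite leNgt; apply/negP => vu.
have K1 : 0 < `|K| + 1 by rewrite ltr_wpDl.
have d0 : 0 < (u - v) / 2 / (`|K| + 1) by rewrite !divr_gt0 ?subr_gt0.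
have := h _ d0; set e := _ / _ / _ in d0 *.
have eK : e * (`|K| + 1) = (u - v) / 2 by rewrite divfK ?gt_eqF.
have := ler_norm K; nra.
Qed.

Lemma nrm_le_eps x K : (forall e, 0 < e -> nrm x <= e * K) -> x = 0.
Proof.
move=> h; apply/nrm_eq0/le_anti/andP; split; last exact: nrm_ge0.
by apply: (@le_of_le_eps _ _ K) => e /h; rewrite add0r.
Qed.

(** [M] is not assumed closed, so that the lemma also applies to ranges; the nearest point l lies in
    the closure of [M]. *)
Lemma approximate_projection M z : linear_subspace M ->
  exists2 l, approximable M l & forall y, M y -> re_inner (z - l) y = 0.
Proof.
move=> sM; have [M0 MD MZ] := sM.
pose E := [set nrm (z - x) ^+ 2 | x in M]; pose D := inf E.
have E0 : has_inf E.
  split; first by exists (nrm (z - 0) ^+ 2), 0.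
  by exists 0 => _ [x _ <-]; exact: sqr_ge0.
have Dle x : M x -> D <= nrm (z - x) ^+ 2.
  by move=> Mx; apply: ge_inf; [case: E0|exists x].
pose P (e : R) x := M x /\ nrm (z - x) ^+ 2 <= D + e.
have [|d e x de [Mx xd]|e e0|l Pl] := @nrm_cantor R H P.
- move=> e e0; have [_ [x Mx <-] xD] := inf_adherent e0 E0.
  by exists x; split => //; exact: ltW.
- by split => //; apply: le_trans xd _; rewrite lerD2l.
(* With m the midpoint of x and y, the parallelogram law gives ||x - y||^2 <= 4 (D + d) - 4 ||z -
   m||^2 <= 4 d. *)
- exists (e ^+ 2 / 4) => [|x y [Mx xD] [My yD]]; first by rewrite divr_gt0 ?exprn_gt0.
  rewrite -(@ler_pXn2r _ 2) ?nnegrE ?nrm_ge0 ?(ltW e0)//.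
  pose m := (2^-1 : R)%:C%C *: (x + y).
  have mD : D <= nrm (z - m) ^+ 2 by apply: Dle; apply/MZ/MD.
  have mE : nrm ((z - x) + (z - y)) = 2 * nrm (z - m).
    rewrite -nrmZr //; congr nrm; rewrite scalerBr scalerA -rmorphM /= divff //.
    by rewrite scale1r rmorphD /= scalerDl !scale1r opprD addrACA.
  have := parallelogram (z - x) (z - y); rewrite mE.
  have -> : z - x - (z - y) = y - x by rewrite opprB addrC addrA subrK.
  by rewrite (nrmBC y x); lra.
exists l; first by move=> e /Pl [x [Mx _] xl]; exists x.
have le y : M y -> re_inner (z - l) y <= 0.
  move=> My; rewrite leNgt; apply/negP; set r := re_inner _ _ => r0.
  have n0 := nrm_ge0 y; set n := nrm y in n0.
  (* First variation: x + t y lies in [M], so it is no nearer to z than D, while x is e-optimal and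
     e-close to l. *)
  have key t : 0 < t -> 2 * t * r <= t ^+ 2 * n ^+ 2.
    move=> t0; apply: (@le_of_le_eps _ _ (1 + 2 * t * n)) => e e0.
    have [x [Mx xD] xl] := Pl _ e0.
    have Mt : M (x + t%:C%C *: y) by apply/MD/MZ.
    have := Dle _ Mt; rewrite opprD addrA nrmB2 re_innerZr nrmZr ?(ltW t0) // -/n.
    have -> : re_inner (z - x) y = r - re_inner (x - l) y.
      by rewrite -re_innerBl opprB addrA subrK.
    have := cauchy_schwarz (x - l) y; rewrite ler_norml -/n => /andP[_ cs].
    have cs' : re_inner (x - l) y <= e * n by apply: le_trans cs _; exact: ler_wpM2r.
    by rewrite exprMn; nra.
  (* A t small enough that the quadratic term cannot dominate; the summand 1 covers n = 0. *)
  have t0 : 0 < r / (n ^+ 2 + 1) by rewrite divr_gt0 // ltr_wpDl ?sqr_ge0.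
  have := key _ t0; set t := _ / _ in t0 *.
  have tE : t * (n ^+ 2 + 1) = r by rewrite divfK // gt_eqF // ltr_wpDl ?sqr_ge0.
  by rewrite -tE; nra.
move=> y My; apply/le_anti; rewrite le //= -oppr_le0 -re_innerNr le //.
by rewrite -scaleN1r; exact: MZ.
Qed.

Section ClosedSubspace.
Variables (M : set H) (sM : linear_subspace M) (cM : closed M).
Let P := orthogonal_projection M.

Lemma orthogonal_complementP x :
  (forall y, M y -> re_inner x y = 0) -> orthogonal_complement M x.
Proof. by move=> h y My; apply: inner_eq0 => c; apply: h; case: sM => _ _; apply. Qed.

Lemma orthogonal_projectionP x : M (P x) /\ orthogonal_complement M (x - P x).
Proof.
have [l /(closed_approximable _ _ cM) Ml lo] := approximate_projection M x sM.
rewrite /P /orthogonal_projection; apply: (@xgetPex _ 0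
  [set y | M y /\ orthogonal_complement M (x - y)]).
by exists l; split => //; exact: orthogonal_complementP.
Qed.

Lemma projection_in x : M (P x). Proof. by case: (orthogonal_projectionP x). Qed.

Lemma projection_orth x y : M y -> re_inner (x - P x) y = 0.
Proof. by case: (orthogonal_projectionP x) => _ h /h; rewrite /re_inner => ->. Qed.

Lemma projection_unique x y :
  M y -> (forall w, M w -> re_inner (x - y) w = 0) -> P x = y.
Proof.
move=> My yo; apply/eqP; rewrite -subr_eq0; apply/eqP/nrm_eq0/eqP.
have MPy : M (P x - y) by apply: linear_subspaceB => //; exact: projection_in.
rewrite -sqrf_eq0 -re_inner_norm -{1}[P x](subrK x) -addrA re_innerDl yo //.
by rewrite -opprB re_innerNl projection_orth // oppr0 addr0.
Qed.

Lemma projection_id x : M x -> P x = x.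
Proof. by move=> Mx; apply: projection_unique => // w _; rewrite subrr re_inner0l. Qed.

Lemma projection_orth0 x : (forall w, M w -> re_inner x w = 0) -> P x = 0.
Proof. by move=> h; apply: projection_unique => [|w /h]; [case: sM|rewrite subr0]. Qed.

Lemma projection_linear : linear P.
Proof.
have [_ MD MZ] := sM.
move=> c x y; apply: projection_unique.
  by apply: MD; [apply: MZ|]; exact: projection_in.
move=> w Mw; rewrite opprD addrACA -scalerBr re_innerDl re_innerJ.
by rewrite !projection_orth ?addr0 //; exact: MZ.
Qed.

Lemma projection_sym x y : re_inner (P x) y = re_inner x (P y).
Proof.
have h u v : re_inner (P u) v = re_inner (P u) (P v).
  rewrite re_innerC [RHS]re_innerC; apply/eqP; rewrite -subr_eq0 -re_innerBl.
  by rewrite projection_orth //; exact: projection_in.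
by rewrite h re_innerC -h re_innerC.
Qed.

Lemma projection_norm2 x : re_inner (P x) x = nrm (P x) ^+ 2.
Proof. rewrite -re_inner_norm [RHS]projection_sym (projection_id (P x)) 1?re_innerC //.
exact: projection_in. Qed.

Lemma projection_le x : nrm (P x) <= nrm x.
Proof.
have := projection_norm2 x; have := cauchy_schwarz (P x) x.
rewrite ler_norml => /andP[_].
have := nrm_ge0 (P x); have := nrm_ge0 x; nra.
Qed.

End ClosedSubspace.

(** The trivial orthogonal complement makes the range dense; the lower bound gives injectivity,
    makes approximate preimages Cauchy, and bounds the inverse by 1 / k. *)
Lemma bounded_below_inverse A k : linear A -> nrm_bounded A -> 0 < k ->
  (forall x, k * nrm x <= nrm (A x)) ->
  (forall y, (forall x, re_inner (A x) y = 0) -> y = 0) ->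
  exists B, [/\ bounded_operator B, B \o A = id & A \o B = id].
Proof.
move=> lA [K K0 bA] k0 kA oA.
have injA x y : A x = A y -> x = y.
  move=> e; apply/eqP; rewrite -subr_eq0; apply/eqP/nrm_eq0/le_anti.
  by rewrite nrm_ge0 andbT -(pmulr_rle0 _ k0) (le_trans (kA _)) // linPB // e subrr nrm0.
have surj y : exists x, A x = y.
  have [l Al lo] := approximate_projection _ y (linear_subspace_range A lA).
  have yl : y = l.
    apply/eqP; rewrite -subr_eq0; apply/eqP/oA => x.
    by rewrite re_innerC lo //; exists x.
  subst l.
  have [|d e x de xd|e e0|w Pw] := @nrm_cantor R H (fun e x => nrm (A x - y) <= e).
  - by move=> e /Al [_ [x _ <-] xe]; exists x.
  - exact: le_trans xd de.
  - exists (e * k / 2) => [|u v ue ve]; first by rewrite divr_gt0 ?mulr_gt0.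
    rewrite -(ler_pM2l k0); apply: le_trans (kA _) _; rewrite linPB //.
    apply: le_trans (nrm_dist _ y _) _; rewrite (nrmBC y).
    by apply: le_trans (lerD ue ve) _; lra.
  exists w; apply/eqP; rewrite -subr_eq0; apply/eqP/(@nrm_le_eps _ (K + 1)) => e e0.
  have [x xe xw] := Pw _ e0; apply: le_trans (nrm_dist _ (A x) _) _.
  rewrite -linPB // mulrDr mulr1; apply: lerD => //; apply: le_trans (bA _) _.
  by rewrite nrmBC mulrC ler_wpM2r // ltW.
have [B BE] := choice surj.
have lB : linear B by move=> c x y; apply: injA; rewrite BE lA !BE.
exists B; split; last by apply/funext => x /=.
- apply/bounded_operatorP => //; exists k^-1 => [|x]; first by rewrite invr_gt0.
  by rewrite mulrC ler_pdivlMr // mulrC -{2}[x]BE.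
- by apply/funext => x /=; apply: injA; rewrite BE.
Qed.

End Projection.

(** * Spectrum of positive operators and monotonicity *)

Section PositiveOperators.
Context {R : realType} {H : hilbertSpace R}.
Implicit Types (x y z w : H) (l : R[i]) (A B T : H -> H) (q : R).

Definition re_symmetric A := forall x y, re_inner (A x) y = re_inner x (A y).
Definition re_positive A := forall x, 0 <= re_inner (A x) x.

Lemma re_symmetricN A B : re_symmetric A -> re_symmetric B -> re_symmetric (A \- B).
Proof. by move=> sA sB x y; rewrite re_innerBl re_innerBr sA sB. Qed.

(** Positivity is tested at x - t A x. The choice t = 1 / q gives ||Ax||^2 <= q^2 ||x||^2; for q =
    0, t = 1 does. *)
Lemma positive_nrm_le A q : linear A -> re_symmetric A -> re_positive A -> 0 <= q ->
  (forall x, re_inner (A x) x <= q * nrm x ^+ 2) -> forall x, nrm (A x) <= q * nrm x.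
Proof.
move=> lA sA pA q0 Aq x.
have key (t : R) : 0 <= q * nrm x ^+ 2 - 2 * t * nrm (A x) ^+ 2 + t ^+ 2 * (q * nrm (A x) ^+ 2).
  have := pA (x - t%:C%C *: A x); rewrite linPB // linPZ //.
  rewrite !(re_innerBl, re_innerBr, re_innerZl, re_innerZr) (sA (A x) x) re_inner_norm.
  have := Aq x; have := Aq (A x); nra.
rewrite -(@ler_pXn2r _ 2) ?nnegrE ?nrm_ge0 ?mulr_ge0 ?nrm_ge0 // exprMn.
have [q_eq0|qn0] := eqVneq q 0.
  by have := key 1; rewrite q_eq0; nra.
have := key q^-1; set s := q^-1.
have qs : q * s = 1 by rewrite divff.
have s0 : 0 <= s by rewrite invr_ge0.
move=> h; have := mulr_ge0 q0 h.
have -> : q * (q * nrm x ^+ 2 - 2 * s * nrm (A x) ^+ 2 + s ^+ 2 * (q * nrm (A x) ^+ 2)) =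
  q ^+ 2 * nrm x ^+ 2 - 2 * (q * s) * nrm (A x) ^+ 2 + (q * s) ^+ 2 * nrm (A x) ^+ 2 by ring.
by rewrite qs; lra.
Qed.

(** Since q also bounds the norm of [A], unit vectors satisfy ||Ax - qx||^2 <= 2q (q - <Ax, x>),
    which is small near the supremum. *)
Lemma approximate_eigenvalue A : linear A -> re_symmetric A -> re_positive A ->
  nrm_bounded A -> (exists x : H, x <> 0) ->
  exists q, [/\ 0 <= q, forall x, re_inner (A x) x <= q * nrm x ^+ 2 &
    forall e, 0 < e -> exists2 x, nrm x = 1 & nrm (A x - q%:C%C *: x) <= e].
Proof.
move=> lA sA pA [K K0 bA] [x0 /eqP x00].
pose E := [set re_inner (A x) x | x in [set x : H | nrm x = 1]].
have unit_of x : x != 0 -> exists2 u, nrm u = 1 & x = (nrm x)%:C%C *: u.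
  move=> xn0; have n0 : nrm x != 0 by apply: contra_neq xn0 => /nrm_eq0.
  exists ((nrm x)^-1%:C%C *: x); first by rewrite nrmZr ?invr_ge0 ?nrm_ge0 // mulVf.
  by rewrite scalerA -rmorphM /= divff // scale1r.
have E_sup : has_sup E.
  split; first by have [u u1 _] := unit_of _ x00; exists (re_inner (A u) u), u.
  exists K => _ [x /= x1 <-]; have := cauchy_schwarz (A x) x.
  have := bA x; rewrite x1 ler_norml !mulr1 => h /andP[_]; lra.
pose q := sup E.
have Eq x : nrm x = 1 -> re_inner (A x) x <= q.
  by move=> x1; apply: ub_le_sup; [case: E_sup|exists x].
have q0 : 0 <= q by have [u u1 _] := unit_of _ x00; apply: le_trans (pA u) (Eq _ u1).
have Aq x : re_inner (A x) x <= q * nrm x ^+ 2.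
  have [->|/unit_of [u u1 ->]] := eqVneq x 0.
    by rewrite linP0 // re_inner0l nrm0 expr0n mulr0.
  set n := nrm x; rewrite linPZ // re_innerZl re_innerZr nrmZr ?nrm_ge0 // u1 mulr1.
  by rewrite mulrA -expr2 mulrC ler_wpM2r ?sqr_ge0 // Eq.
exists q; split => // e e0.
have d0 : 0 < e ^+ 2 / (2 * q + 1) by rewrite divr_gt0 ?exprn_gt0 // ltr_wpDl ?mulr_ge0.
have [_ [x /= x1 <-] xq] := sup_adherent d0 E_sup; exists x => //.
set d := _ / _ in d0 xq.
have dE : d * (2 * q + 1) = e ^+ 2 by rewrite divfK // gt_eqF // ltr_wpDl ?mulr_ge0.
rewrite -(@ler_pXn2r _ 2) ?nnegrE ?nrm_ge0 ?(ltW e0) //.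
rewrite nrmB2 re_innerZr nrmZr // x1 mulr1.
have := positive_nrm_le _ _ lA sA pA q0 Aq x; rewrite x1 mulr1 => nq.
have := nrm_ge0 (A x); have := Eq _ x1; rewrite -/q in xq; nra.
Qed.

(* On an approximate eigenvector of [B - T] for [s = sup <(B - T) x, x>], [B x]
   is close to [T x + s x]; if [s > 0] then [nrm (B x) > nrm (T x)]. *)
Lemma square_monotone B T : linear B -> linear T ->
  re_symmetric B -> re_symmetric T -> re_positive T ->
  nrm_bounded B -> nrm_bounded T -> (forall x, nrm (B x) <= nrm (T x)) ->
  forall x, re_inner (B x) x <= re_inner (T x) x.
Proof.
move=> lB lT sB sT pT [KB KB0 bB] [KT KT0 bT] BT x0.
rewrite leNgt; apply/negP => lt0.
have x0n0 : x0 <> 0 by move=> e; move: lt0; rewrite e !linP0 // re_inner0l ltxx.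
(* B - T need not be positive; adding [K], a bound of its norm, makes it so, and s becomes p - K. *)
pose K := KB + KT; pose P x := B x - T x + K%:C%C *: x.
have K0 : 0 < K by rewrite addr_gt0.
have bD x : nrm (B x - T x) <= K * nrm x.
  by apply: le_trans (nrmD _ _) _; rewrite nrmN mulrDl lerD.
have lP : linear P.
  exact: (linear_addf _ _ (linear_subf _ _ lB lT) (linear_scalef _ _ linear_idf)).
have sP : re_symmetric P.
  by move=> x y; rewrite !(re_innerDl,re_innerDr,re_innerNl,re_innerNr) re_innerZl re_innerZr sB sT.
have pP : re_positive P.
  move=> x; rewrite re_innerDl re_innerZl re_inner_norm.
  have := cauchy_schwarz (B x - T x) x; rewrite ler_norml => /andP[h _].
  have := bD x; have := nrm_ge0 x; nra.
have bP : nrm_bounded P.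
  exists (K + K); first by rewrite addr_gt0.
  move=> x; apply: le_trans (nrmD _ _) _; rewrite mulrDl lerD //.
  by rewrite nrmZr // ltW.
have [p [p0 Pp eP]] := approximate_eigenvalue _ lP sP pP bP (ex_intro (fun x => x <> 0) _ x0n0).
have Kp : K < p.
  have := Pp x0; rewrite re_innerDl re_innerZl re_inner_norm re_innerBl.
  have := sqr_ge0 (nrm x0); nra.
suff : (p - K) ^+ 2 <= 0 by nra.
(* With B x = T x + s x + v and ||v|| <= e, expanding ||Bx||^2 <= ||Tx||^2 and dropping nonnegative
   terms leaves s^2 <= -2 <Tx, v> - 2s <x, v>. *)
apply: (@le_of_le_eps _ _ _ (2 * KT + 2 * (p - K))) => e e0.
have [x x1 xe] := eP _ e0; set v := _ - _ in xe.
have BE : B x = T x + ((p - K)%:C%C *: x + v).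
  rewrite /v /P rmorphB /= scalerBl; set a := p%:C%C *: x; set b := _ *: x.
  by rewrite -[LHS](subrKC (T x)); congr (_ + _); rewrite [RHS]addrC addrA subrK addrK.
have := BT x; rewrite -(@ler_pXn2r _ 2) ?nnegrE ?nrm_ge0 // BE nrmD2 nrmD2.
rewrite re_innerDr re_innerZr re_innerZl nrmZr ?subr_ge0 ?(ltW Kp) // x1.
have := cauchy_schwarz (T x) v; have := cauchy_schwarz x v.
have := bT x; rewrite x1 mul1r mulr1 !ler_norml => Tx /andP[xv _] /andP[Txv _].
rewrite mulr1 in Tx; have Tve : nrm (T x) * nrm v <= KT * e by rewrite ler_pM ?nrm_ge0.
have pxv : 0 <= (p - K) * (re_inner x v + e) by rewrite mulr_ge0 //; lra.
have pTx : 0 <= (p - K) * re_inner (T x) x by rewrite mulr_ge0 //; lra.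
have := sqr_ge0 (nrm v). lra.
Qed.

(** For |l| > q both A - l and its adjoint A - conj l are bounded below by |l| - q; the second bound
    makes the range of the first dense. *)
Lemma spectrum_bound A q : linear A -> re_symmetric A -> re_positive A -> 0 <= q ->
  (forall x, re_inner (A x) x <= q * nrm x ^+ 2) ->
  forall l, spectrum A l -> complex.Re `|l| <= q.
Proof.
move=> lA sA pA q0 Aq l spl; rewrite leNgt; apply/negP => ql; apply: spl.
have bA := positive_nrm_le _ _ lA sA pA q0 Aq.
set n := complex.Re `|l| in ql.
have kb l' x : complex.Re `|l'| = n -> (n - q) * nrm x <= nrm (A x - l' *: x).
  move=> ln; have := nrmD (l' *: x - A x) (A x); rewrite subrK nrmZ ln nrmBC.
  have := bA x; lra.
apply: (@bounded_below_inverse _ _ _ (n - q)).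
- exact: (linear_subf _ _ lA (linear_scalef _ _ linear_idf)).
- exists (q + n) => [|x /=]; first by apply: lt_le_trans (le_lt_trans q0 ql) _; rewrite lerDr.
  by apply: le_trans (nrmD _ _) _; rewrite nrmN nrmZ mulrDl lerD.
- by rewrite subr_gt0.
- by move=> x; exact: kb.
- move=> y oy; have Ay : A y - conjc l *: y = 0.
    apply: re_inner_eq0 => x; rewrite re_innerC re_innerBr -sA.
    by have := oy x; rewrite /= re_innerBl re_innerJ.
  have := kb (conjc l) y; rewrite Ay nrm0 normcJ => /(_ erefl).
  by rewrite pmulr_rle0 ?subr_gt0 // => h; apply/nrm_eq0/le_anti; rewrite h nrm_ge0.
Qed.

Lemma approximate_eigenvalue_spectrum A l :
  (forall e, 0 < e -> exists2 x, nrm x = 1 & nrm (A x - l *: x) <= e) -> spectrum A l.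
Proof.
move=> h [B [bB BA _]]; have [lB _] := bB.
have [K K0 bK] := (bounded_operatorP B lB).1 bB.
(* An inverse bounded by [K] would give 1 = ||x|| <= K / (2K). *)
have d0 : 0 < (2 * K)^-1 by rewrite invr_gt0 mulr_gt0.
have [x x1 xe] := h _ d0; have /(congr1 (@^~ x)) /= Bx := BA.
have := bK (A x - l *: x); rewrite Bx x1 => le1.
have : 1 <= K * (2 * K)^-1 by apply: le_trans le1 _; rewrite ler_pM2l.
rewrite invfM mulrCA divff ?gt_eqF // mulr1; lra.
Qed.

Lemma spectral_radius_monotone A B : linear A -> linear B ->
  re_symmetric A -> re_symmetric B -> re_positive A -> nrm_bounded B ->
  (forall x, re_inner (A x) x <= re_inner (B x) x) ->
  spectral_radius A <= spectral_radius B.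
Proof.
move=> lA lB sA sB pA bB AB.
have pB : re_positive B by move=> x; apply: le_trans (pA x) (AB x).
have [[x0 x00]|trivH] := pselect (exists x : H, x <> 0).
- have [q [q0 Bq eB]] := approximate_eigenvalue _ lB sB pB bB (ex_intro (fun x => x <> 0) _ x00).
  have spA := spectrum_bound _ _ lA sA pA q0 (fun x => le_trans (AB x) (Bq x)).
  have spB := spectrum_bound _ _ lB sB pB q0 Bq.
  have qB : spectrum B q%:C%C by apply: approximate_eigenvalue_spectrum.
  have q_le : q <= spectral_radius B.
    apply: ub_le_sup; first by exists q => _ [l /spB lq <-].
    by exists q%:C%C => //; rewrite ger0_norm ?ler0c.
  apply: le_trans q_le; rewrite /spectral_radius.
  have [->|/set0P E0] := eqVneq [set complex.Re `|l| | l in spectrum A] set0.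
    by rewrite sup0.
  by apply: ge_sup => // _ [l /spA lq <-].
(* On the zero space every operator is inverted by [id], so both spectra are empty. *)
- have H0 (x : H) : x = 0 by apply: contra_notP trivH => x0; exists x.
  have sp0 (C : H -> H) : spectrum C = set0.
    apply/seteqP; split => // l; apply; exists id.
    by split; [split => // x|apply/funext => x; rewrite [LHS]H0 [RHS]H0..].
  by rewrite /spectral_radius !sp0.
Qed.

End PositiveOperators.

(** * Square root of a positive contraction *)

Section SquareRoot.
Context {R : realType} {H : hilbertSpace R}.
Variables (A : H -> H) (lA : linear A) (sA : re_symmetric A) (pA : re_positive A).
Hypothesis A_le1 : forall x, re_inner (A x) x <= nrm x ^+ 2.

Let X : H -> H := id \- A.

(* The iteration converges to [1 - A^(1/2)], the solution of [2 Y = X + Y^2];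
   the scalar iteration [sqrt_bound], with [X] replaced by [1], majorizes the
   norms of the iterates and of their differences. *)
Fixpoint sqrt_iter n : H -> H :=
  if n is n'.+1 then fun x => (2^-1 : R)%:C%C *: (X x + sqrt_iter n' (sqrt_iter n' x))
  else fun=> 0.

Fixpoint sqrt_bound n : R := if n is n'.+1 then (1 + sqrt_bound n' ^+ 2) / 2 else 0.

Local Notation Y := sqrt_iter.
Local Notation y := sqrt_bound.

Let lX : linear X. Proof. exact: (linear_subf _ _ linear_idf lA). Qed.

Let sX : re_symmetric X.
Proof. by apply: re_symmetricN => // x z. Qed.

Let nX x : nrm (X x) <= nrm x.
Proof.
rewrite -[leRHS]mul1r; apply: positive_nrm_le => // {}x.
  by rewrite re_innerBl re_inner_norm subr_ge0.
by rewrite mul1r re_innerBl re_inner_norm gerBl.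
Qed.

Let y01 n : 0 <= y n <= 1.
Proof. by elim: n => [|n /andP[y0 y1]] /=; rewrite ?lexx ?ler01 //; nra. Qed.

Let y_mono n : y n <= y n.+1.
Proof. by have /andP[] := y01 n => /=; nra. Qed.

Let lY n : linear (Y n).
Proof.
elim: n => [|n IH] /=; first by move=> c x z; rewrite scaler0 addr0.
exact: (linear_scalef _ _ (linear_addf _ _ lX (linear_comp _ _ IH IH))).
Qed.

Let sY n : re_symmetric (Y n).
Proof.
elim: n => [|n IH] x z /=; first by rewrite re_inner0l re_innerC re_inner0l.
by rewrite re_innerZl re_innerZr re_innerDl re_innerDr sX !IH.
Qed.

Let nY n x : nrm (Y n x) <= y n * nrm x.
Proof.
elim: n x => [|n IH] x /=; first by rewrite nrm0 mul0r.
rewrite nrmZr //; have := nrmD (X x) (Y n (Y n x)).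
have := nX x; have := IH (Y n x); have := IH x; have /andP[] := y01 n.
have := nrm_ge0 x; nra.
Qed.

(** The splitting b^2 - a^2 = b (b - a) + (b - a) a is valid for operators not known to commute, and
    the scalar iteration obeys the same identity. *)
Let dY n x : nrm (Y n.+1 x - Y n x) <= (y n.+1 - y n) * nrm x.
Proof.
elim: n x => [|n IH] x.
  have := nX x; rewrite /= addr0 subr0 nrmZr //; have := nrm_ge0 x.
  by rewrite expr0n /=; lra.
have -> : Y n.+2 x - Y n.+1 x = (2^-1 : R)%:C%C *:
    (Y n.+1 (Y n.+1 x - Y n x) + (Y n.+1 (Y n x) - Y n (Y n x))).
  by rewrite (linPB _ (lY _)) addrA subrK -scalerBr opprD addrACA subrr add0r.
have yE m : y m.+1 = (1 + y m ^+ 2) / 2 by [].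
have -> : y n.+2 - y n.+1 = (y n.+1 * (y n.+1 - y n) + (y n.+1 - y n) * y n) / 2.
  have := yE n.+1; have := yE n.
  by move: (y n.+2) (y n.+1) (y n) => a b c ? ?; lra.
rewrite nrmZr //; have := nrmD (Y n.+1 (Y n.+1 x - Y n x)) (Y n.+1 (Y n x) - Y n (Y n x)).
have := nY n.+1 (Y n.+1 x - Y n x); have := IH (Y n x).
have := IH x; have := nY n x; have /andP[] := y01 n.+1; have := y_mono n.
move: (y n.+1) (y n) => b a ab b0 _ h1 h2 h3 h4 h5.
have k1 : b * nrm (Y n.+1 x - Y n x) <= b * ((b - a) * nrm x) by rewrite ler_wpM2l.
have k2 : (b - a) * nrm (Y n x) <= (b - a) * (a * nrm x) by rewrite ler_wpM2l ?subr_ge0.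
by move: h3 h4 h5; lra.
Qed.

Let dY_le m n x : (m <= n)%N -> nrm (Y n x - Y m x) <= (y n - y m) * nrm x.
Proof.
move=> /subnK <-; elim: (n - m)%N => [|k IH]; first by rewrite !subrr nrm0 mul0r.
rewrite addSn; apply: le_trans (nrm_dist _ (Y (k + m) x) _) _.
by have := dY (k + m) x; move: IH; lra.
Qed.

(** The gap c - y n is the error bound for the n-th iterate, uniform on the unit ball. *)
Let c : R := sup (range y).

Let y_sup : has_sup (range y).
Proof.
split; first by exists (y 0), 0%N.
by exists 1 => _ [n _ <-]; case/andP: (y01 n).
Qed.

Let y_le_c n : y n <= c.
Proof. by apply: ub_le_sup; [case: y_sup|exists n]. Qed.

Let y_near_c e : 0 < e -> exists n, c - y n <= e.
Proof.
move=> e0; have [_ [n _ <-] h] := sup_adherent e0 y_sup; exists n.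
by rewrite -/c in h; lra.
Qed.

Let dY_c m n x : nrm (Y n x - Y m x) <= ((c - y n) + (c - y m)) * nrm x.
Proof.
have := nrm_ge0 x; have := y_le_c m; have := y_le_c n.
have [mn|/ltnW nm] := leqP m n; first by have := dY_le _ _ x mn; nra.
by rewrite nrmBC; have := dY_le _ _ x nm; nra.
Qed.

Let iter_limit x : exists l, forall n, nrm (Y n x - l) <= (c - y n) * nrm x.
Proof.
have n1 : 0 < nrm x + 1 by rewrite ltr_wpDl ?nrm_ge0.
have [|d e z de [n [-> nd]]|e e0|l Pl] := @nrm_cantor R H
  (fun e z => exists n, z = Y n x /\ c - y n <= e).
- by move=> e /y_near_c [n yn]; exists (Y n x), n.
- by exists n; split => //; apply: le_trans de.
- exists (e / (nrm x + 1) / 2) => [|_ _ [n [-> nd]] [m [-> md]]].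
    by rewrite !divr_gt0.
  apply: le_trans (dY_c _ _ _) _.
  set d := e / _ in nd md; have dE : d * (nrm x + 1) = e by rewrite divfK ?gt_eqF.
  have d0 : 0 < d by rewrite divr_gt0.
  have dd : (c - y n) + (c - y m) <= d by lra.
  apply: (@le_trans _ _ (d * nrm x)); first by rewrite ler_wpM2r ?nrm_ge0.
  by rewrite -dE ler_wpM2l ?(ltW d0) // lerDl.
exists l => n; apply: (@le_of_le_eps _ _ _ (nrm x + 1)) => e e0.
have [_ [m [-> me]] le] := Pl _ e0; apply: le_trans (nrm_dist _ (Y m x) _) _.
have := dY_c m n x; have := nrm_ge0 x; nra.
Qed.

Lemma square_root_exists :
  exists B, [/\ linear B, nrm_bounded B, re_symmetric B, re_positive B & B \o B = A].
Proof.
have [L LE] := choice iter_limit.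
have Lb e n x : c - y n <= e -> nrm (L x - Y n x) <= e * nrm x.
  move=> h; rewrite nrmBC; apply: le_trans (LE _ _) _.
  by rewrite ler_wpM2r ?nrm_ge0.
have nL x : nrm (L x) <= nrm x.
  apply: (@le_of_le_eps _ _ _ (nrm x)) => e /y_near_c [n ne].
  rewrite -[L x](subrK (Y n x)); apply: le_trans (nrmD _ _) _.
  have := Lb _ _ x ne; have := nY n x; have := y01 n; have := nrm_ge0 x; nra.
have lL : linear L.
  move=> a x z; apply/eqP; rewrite -subr_eq0; apply/eqP.
  apply: (@nrm_le_eps _ _ _ (nrm (a *: x + z) + complex.Re `|a| * nrm x + nrm z)) => e.
  move=> /y_near_c [n ne].
  have -> : L (a *: x + z) - (a *: L x + L z) = (L (a *: x + z) - Y n (a *: x + z))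
      - a *: (L x - Y n x) - (L z - Y n z).
    rewrite (lY n a x z) scalerBr.
    by apply: re_inner_ext => w; rewrite !(re_innerDl, re_innerNl); ring.
  apply: le_trans (nrmD _ _) _; rewrite nrmN.
  have := Lb _ _ z ne; have := Lb _ _ (a *: x + z) ne; have := Lb _ _ x ne.
  have := nrmD (L (a *: x + z) - Y n (a *: x + z)) (- (a *: (L x - Y n x))).
  rewrite nrmN nrmZ; set r := complex.Re `|a|.
  have r0 : 0 <= r by rewrite -ler0c RRe_ge0.
  nra.
have sL : re_symmetric L.
  have h x z : re_inner (L x) z <= re_inner x (L z).
    apply: (@le_of_le_eps _ _ _ (2 * nrm x * nrm z)) => e /y_near_c [n ne].
    have -> : re_inner (L x) z = re_inner (L x - Y n x) z + re_inner x (L z)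
        - re_inner x (L z - Y n z).
      by rewrite re_innerBl re_innerBr sY; ring.
    have := cauchy_schwarz (L x - Y n x) z; have := cauchy_schwarz x (L z - Y n z).
    rewrite !ler_norml => /andP[h1 _] /andP[_ h2].
    have := ler_wpM2r (nrm_ge0 z) (Lb _ _ x ne).
    have := ler_wpM2l (nrm_ge0 x) (Lb _ _ z ne); lra.
  move=> x z; apply/le_anti; rewrite h /= re_innerC [leRHS]re_innerC; exact: h.
have LL x : L x + L x = X x + L (L x).
  apply/eqP; rewrite -subr_eq0; apply/eqP.
  (* Two errors come from the left side and two from the square, each at most e ||x||, as [Y n] and
     [L] are contractions. *)
  apply: (@nrm_le_eps _ _ _ (4 * nrm x)) => e /y_near_c [n ne].
  have ne' : c - y n.+1 <= e by have := y_mono n; lra.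
  have YE : Y n.+1 x + Y n.+1 x = X x + Y n (Y n x).
    rewrite /= -scalerDl -rmorphD /= (_ : 2^-1 + 2^-1 = 1 :> R) ?scale1r //; lra.
  have -> : L x + L x - (X x + L (L x)) = (L x - Y n.+1 x) + (L x - Y n.+1 x)
      + (Y n (Y n x - L x) + (Y n (L x) - L (L x))).
    apply: re_inner_ext => w; have := congr1 (re_inner^~ w) YE.
    by rewrite (linPB _ (lY n)) !(re_innerDl, re_innerNl); lra.
  have := nrmD (L x - Y n.+1 x + (L x - Y n.+1 x)) (Y n (Y n x - L x) + (Y n (L x) - L (L x))).
  have := nrmD (L x - Y n.+1 x) (L x - Y n.+1 x).
  have := nrmD (Y n (Y n x - L x)) (Y n (L x) - L (L x)).
  have := nY n (Y n x - L x); rewrite (nrmBC (Y n x)) (nrmBC (Y n (L x))).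
  have := Lb _ _ x ne; have := Lb _ _ x ne'; have := Lb _ _ (L x) ne; have := nL x.
  have /andP[] := y01 n; have := nrm_ge0 (L x - Y n x); have : 0 <= e.
    by have := y_le_c n; lra.
  nra.
(* The equation 2L = X + L^2 reads (1 - L)^2 = 1 - X = A. *)
exists (id \- L); split.
- exact: (linear_subf _ _ linear_idf lL).
- exists 2 => // x /=; apply: le_trans (nrmD _ _) _; rewrite nrmN.
  by have := nL x; lra.
- by apply: re_symmetricN => // x z.
- move=> x /=; rewrite re_innerBl re_inner_norm.
  have := cauchy_schwarz (L x) x; rewrite ler_norml => /andP[_].
  have := nL x; have := nrm_ge0 x; nra.
apply/funext => x; apply: re_inner_ext => w; have := congr1 (re_inner^~ w) (LL x).
by rewrite /X /= (linPB _ lL) !(re_innerDl, re_innerNl); lra.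
Qed.

End SquareRoot.

(** * Existence of the polar factor *)

Section Polar.
Context {R : realType} {H : hilbertSpace R}.
Variables (S B : H -> H) (lS : linear S) (lB : linear B) (sB : re_symmetric B).
Hypothesis SB : forall x, nrm (S x) = nrm (B x).

(** The range of [B] is not known to be closed here, so the projection is taken onto its closure. *)
Let M : set H := approximable (range B).

Let M_subspace : linear_subspace M.
Proof.
have [M0 MD MZ] := linear_subspace_range _ lB; split.
- by move=> e e0; exists 0 => //; rewrite subrr nrm0 ltW.
- move=> x y Mx My e e0; have e2 : 0 < e / 2 by rewrite divr_gt0.
  have [u Mu ux] := Mx _ e2; have [v Mv vy] := My _ e2.
  exists (u + v); first exact: MD.
  by rewrite opprD addrACA; apply: le_trans (nrmD _ _) _; lra.
- move=> c x Mx e e0; have c0 : 0 <= complex.Re `|c| by rewrite -ler0c RRe_ge0.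
  have c1 : 0 < complex.Re `|c| + 1 by rewrite ltr_wpDl.
  have [u Mu ux] := Mx _ (divr_gt0 e0 c1); exists (c *: u); first exact: MZ.
  rewrite -scalerBr nrmZ; apply: le_trans (ler_wpM2l c0 ux) _.
  by rewrite mulrA ler_pdivrMr // mulrC ler_wpM2l ?(ltW e0) // lerDl.
Qed.

Let M_closed : closed M.
Proof.
move=> x cMx e e0; have e2 : 0 < e / 2 by rewrite divr_gt0.
have [y [My xy]] : M `&` ball x (e / 2)%:C%C !=set0.
  by apply: cMx; apply: nbhsx_ballx; rewrite ltcR.
have [u Mu uy] := My _ e2; exists u => //.
rewrite -ball_normE /= normE ltcR nrmBC in xy.
by apply: le_trans (nrm_dist _ y _) _; lra.
Qed.

Let P := orthogonal_projection M.

(* The closure of the graph of the isometry [B z |-> S z]. *)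
Let G p u := forall e, 0 < e -> exists2 z, nrm (B z - p) <= e & nrm (S z - u) <= e.

Let G_isometry p u : G p u -> nrm u = nrm p.
Proof.
move=> g; apply/le_anti/andP; split;
  apply: (@le_of_le_eps _ _ _ 2) => e /g [z pz uz].
- have := nrm_dist u (S z) 0; rewrite !subr0 nrmBC SB => h.
  by have := nrm_dist (B z) p 0; rewrite !subr0; lra.
- have := nrm_dist p (B z) 0; rewrite !subr0 nrmBC -SB => h.
  by have := nrm_dist (S z) u 0; rewrite !subr0; lra.
Qed.

Let G_linear c p u q v : G p u -> G q v -> G (c *: p + q) (c *: u + v).
Proof.
move=> gp gq e e0; have c0 : 0 <= complex.Re `|c| by rewrite -ler0c RRe_ge0.
have c1 : 0 < complex.Re `|c| + 1 by rewrite ltr_wpDl.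
have d0 := divr_gt0 e0 c1; set d := _ / _ in d0.
have dE : d * (complex.Re `|c| + 1) = e by rewrite divfK ?gt_eqF.
have [z zp zu] := gp _ d0; have [t tq tv] := gq _ d0.
exists (c *: z + t); rewrite ?lB ?lS opprD addrACA -scalerBr;
  apply: le_trans (nrmD _ _) _; rewrite nrmZ.
- by have := ler_wpM2l c0 zp; lra.
- by have := ler_wpM2l c0 zu; lra.
Qed.

(** By linearity [G] relates 0 to u - v, whose norm is then 0. *)
Let G_unique p u v : G p u -> G p v -> u = v.
Proof.
move=> gu gv; apply/eqP; rewrite -subr_eq0; apply/eqP/nrm_eq0.
have := G_isometry _ _ (G_linear (-1) _ _ _ _ gv gu).
by rewrite !scaleN1r addNr nrm0 addrC.
Qed.

Let G_exists p : M p -> exists u, G p u.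
Proof.
move=> Mp; have [|d e x de [z [-> zd]]|e e0|u Pu] := @nrm_cantor R H
  (fun e u => exists z, u = S z /\ nrm (B z - p) <= e).
- by move=> e /Mp [_ [z _ <-] ze]; exists (S z), z.
- by exists z; split => //; apply: le_trans de.
- exists (e / 2) => [|_ _ [z [-> ze]] [t [-> te]]]; first by rewrite divr_gt0.
  rewrite -linPB // SB linPB //; apply: le_trans (nrm_dist _ p _) _.
  by rewrite (nrmBC p); lra.
by exists u => e /Pu [_ [z [-> ze]] zu]; exists z.
Qed.

Lemma polar_exists :
  exists U, [/\ partial_isometry U, null_space U = null_space S & S = U \o B].
Proof.
(* U is the extended isometry after the projection onto [M], hence zero on the orthogonal complement
   of [M]. *)
have [U gU] := choice (fun x => G_exists _ (projection_in M M_subspace M_closed x)).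
rewrite -/P in gU.
have nU x : nrm (U x) = nrm (P x) by apply: G_isometry.
have lP : linear P by apply: projection_linear.
have lU : linear U.
  move=> c x y; apply: G_unique (gU _) _; rewrite lP; exact: G_linear.
have rangeM z : M (B z) by move=> e e0; exists (B z) => //; rewrite subrr nrm0 ltW.
have UB z : U (B z) = S z.
  apply: G_unique (gU _) _; rewrite /P projection_id // => e e0.
  by exists z; rewrite subrr nrm0 ltW.
have U0 x : U x = 0 <-> P x = 0.
  by split=> e; apply: nrm_eq0; [rewrite -nU e nrm0|rewrite nU e nrm0].
exists U; split.
- split.
    apply/bounded_operatorP => //; exists 1 => // x; rewrite mul1r nU.
    exact: projection_le.
  move=> x Ux; rewrite !normE nU; suff -> : P x = x by [].
  (* x - P x lies in N(U), so it is orthogonal to x; being also orthogonal to P x, it vanishes. *)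
  have Px : P (x - P x) = 0.
    rewrite (linPB _ lP) [P (P x)]projection_id ?subrr //; exact: projection_in.
  have := Ux (x - P x) ((U0 _).2 Px) => /(congr1 (@complex.Re R)).
  rewrite -/(re_inner x (x - P x)) => o1.
  have o2 : re_inner (x - P x) (P x) = 0 by apply: projection_orth => //; exact: projection_in.
  apply/esym/eqP; rewrite -subr_eq0; apply/eqP/nrm_eq0/eqP.
  by rewrite -sqrf_eq0 -re_inner_norm re_innerBr o2 subr0 re_innerC o1.
- apply/seteqP; split => x /= => [/U0 Px|Sx].
    apply: nrm_eq0; rewrite SB; apply/eqP; rewrite -sqrf_eq0 -re_inner_norm sB.
    by rewrite -[x in re_inner x _]subr0 -Px projection_orth.
  have Bx : B x = 0 by apply: nrm_eq0; rewrite -SB Sx nrm0.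
  apply/U0; apply: projection_orth0 => // w Mw.
  apply/eqP; rewrite -normr_eq0 eq_le normr_ge0 andbT.
  apply: (@le_of_le_eps _ _ _ (nrm x)) => e /Mw [_ [z _ <-] ze].
  have -> : re_inner x w = re_inner x (w - B z).
    by rewrite re_innerBr -sB Bx re_inner0l subr0.
  apply: le_trans (cauchy_schwarz _ _) _; rewrite add0r mulrC ler_wpM2r ?nrm_ge0 //.
  by rewrite nrmBC.
- by apply/funext => x /=; rewrite UB.
Qed.

End Polar.

(** * From the definitions by choice to real-part statements *)

Section Bridge.
Context {R : realType} {H : hilbertSpace R}.
Implicit Types (A B U : H -> H).

Lemma positive_operator_re A :
  positive_operator A -> re_symmetric A /\ re_positive A.
Proof.
move=> [aA pA]; split=> [x y|x]; first by rewrite /re_inner aA.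
by have := pA x; rewrite lecE => /andP[].
Qed.

(** The order of [R[i]] also requires <Ax, x> to be real, which holds because symmetry makes it
    self-conjugate. *)
Lemma positive_operatorP A :
  linear A -> re_symmetric A -> re_positive A -> positive_operator A.
Proof.
move=> lA sA pA; have aA : is_adjoint A A by apply/is_adjointP.
split=> // x; have e : inner H (A x) x = conjc (inner H (A x) x).
  by rewrite {1}innerC conjCc -aA.
rewrite lecE /= -/(re_inner (A x) x) pA andbT.
case: (inner H (A x) x) e => a b [] /eqP.
by rewrite -subr_eq0 opprK -mulr2n mulrn_eq0.
Qed.

(** The vector z shows that the choice succeeds, and vectors with the same inner products
    coincide. *)
Lemma adjoint_eq A y z :
  (forall x, inner H (A x) y = inner H x z) -> adjoint A y = z.
Proof.
move=> h; rewrite /adjoint; case: xgetP => [t _ /= ht|]; last by move=> /(_ z).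
apply: re_inner_ext => w; rewrite re_innerC [RHS]re_innerC /re_inner.
by rewrite -h -ht.
Qed.

Lemma opnorm_le A r : linear A -> nrm_bounded A -> opnorm A <= r ->
  forall x, nrm (A x) <= r * nrm x.
Proof.
move=> lA [K K0 bA] Ar x.
have [->|xn0] := eqVneq x 0; first by rewrite linP0 // nrm0 mulr0.
have n0 : 0 < nrm x.
  by rewrite lt_neqAle nrm_ge0 eq_sym andbT; apply: contra_neq xn0 => /nrm_eq0.
rewrite -ler_pdivrMr // mulrC -nrmZr ?invr_ge0 ?nrm_ge0 // -linPZ //.
apply: le_trans Ar; apply: ub_le_sup.
  (* Without an upper bound [sup] would take its default value and not control the norms. *)
  exists K => _ [u /= u1 <-]; apply: le_trans (bA u) _.
  by rewrite -[leRHS]mulr1 ler_wpM2l ?(ltW K0) // -lecR -normE.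
exists ((nrm x)^-1%:C%C *: x) => //=.
by rewrite normE nrmZr ?invr_ge0 ?nrm_ge0 // mulVf ?gt_eqF.
Qed.

Lemma abs_operatorP A C : linear A -> linear C ->
  (forall x y, re_inner (A x) y = re_inner x (C y)) ->
  (forall x, nrm (A x) <= nrm x) ->
  let B := abs_operator A in
  [/\ bounded_operator B, positive_operator B & forall x, nrm (B x) = nrm (A x)].
Proof.
move=> lA lC AC nA /=.
have adjA : adjoint A = C.
  by apply/funext => y; apply: adjoint_eq => x; rewrite (is_adjointP _ _ lC).1.
have lD : linear (adjoint A \o A) by rewrite adjA; exact: linear_comp.
have DE x y : re_inner ((adjoint A \o A) x) y = re_inner (A x) (A y).
  by rewrite adjA /= re_innerC -AC re_innerC.
rewrite /abs_operator /sqrt_operator; set E := [set B | _].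
have [bB pB BB] : E (xget (fun=> 0) E).
  have [| | |B [lB bB sB pB BB]] := square_root_exists _ lD.
  - by move=> x y; rewrite DE re_innerC -DE re_innerC.
  - by move=> x; rewrite DE re_inner_norm sqr_ge0.
  (* The contraction hypothesis on [A] is exactly A^*A <= 1. *)
  - by move=> x; rewrite DE re_inner_norm ler_pXn2r ?nnegrE ?nrm_ge0.
  apply: (@xgetPex _ _ E); exists B; split => //.
    exact/bounded_operatorP.
  exact: positive_operatorP.
split => // x; have [sB _] := positive_operator_re _ pB.
apply/eqP; rewrite -(eqrXn2 (n := 2)) ?nrm_ge0 // -!re_inner_norm -DE sB.
by rewrite re_innerC -(congr1 (@^~ x) BB).
Qed.

Lemma polar_factorP A C : linear A -> linear C ->
  (forall x y, re_inner (A x) y = re_inner x (C y)) ->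
  (forall x, nrm (A x) <= nrm x) ->
  let U := polar_factor A in
  [/\ partial_isometry U, null_space U = null_space A & A = U \o abs_operator A].
Proof.
move=> lA lC AC nA /=; rewrite /polar_factor; set E := [set U | _].
have [[lB _] /positive_operator_re [sB _] nB] := abs_operatorP _ _ lA lC AC nA.
apply: (@xgetPex _ _ E); apply: polar_exists => // x; exact/esym/nB.
Qed.

End Bridge.

(** * Comparison of the two iteration operators *)

Theorem corollary6p10 (R : realType) (H : hilbertSpace R)
    (S : {linear H -> H}) (S_bounded : continuous S)
    (S_closed : closed (range S))
    (T : {linear H -> H}) (T_bounded : continuous T)
    (T_pos : positive_operator T) (T_norm : opnorm T <= 1)
    (T_ker : null_space T = null_space S) (T_closed : closed (range T))
    (S_eq : (S : H -> H) = orthogonal_projection (range S) \o T) :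
  let P_S := orthogonal_projection (range S) in
  let P_T := orthogonal_projection (range T) in
  let V := P_T \- T in
  let U_S := polar_factor S in
  let W := U_S \- S in
  spectral_radius (moore_penrose (P_S \o P_T) \o (P_S \o V))
    <= spectral_radius (adjoint U_S \o W).
Proof.
pose P_S := orthogonal_projection (range S).
pose P_T := orthogonal_projection (range T).
pose V := P_T \- T; pose U := polar_factor S; pose W := U \- S.
change (spectral_radius (moore_penrose (P_S \o P_T) \o (P_S \o V))
  <= spectral_radius (adjoint U \o W)).
have lS : linear S by move=> c x y; exact: linearP.
have lT : linear T by move=> c x y; exact: linearP.
have rS := linear_subspace_range _ lS; have rT := linear_subspace_range _ lT.
have lPS : linear P_S by exact: projection_linear.
have lPT : linear P_T by exact: projection_linear.
have sPT : re_symmetric P_T by move=> x y; exact: projection_sym.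
have SE x : S x = P_S (T x) by rewrite {1}S_eq.
have [sT pT] := positive_operator_re _ T_pos.
have bT : nrm_bounded T by apply/bounded_operatorP.
have nT x : nrm (T x) <= nrm x.
  by rewrite -[leRHS]mul1r; apply: opnorm_le.
have nS x : nrm (S x) <= nrm (T x) by rewrite SE; exact: projection_le.
have S_adj x y : re_inner (S x) y = re_inner x ((T \o P_S) y).
  by rewrite SE [LHS]projection_sym // sT.
have PTT x : P_T (T x) = T x by apply: projection_id => //; exists x.
have TPT x : T (P_T x) = T x.
  by apply: re_inner_ext => w; rewrite sT sPT PTT sT.
have ker_T x : T x = 0 <-> S x = 0.
  by split=> h; [have : null_space T x by []; rewrite T_ker|
                 have : null_space S x by []; rewrite -T_ker].
(* As T = P_T T P_T, the left side is <T P_T x, P_T x>, at most ||P_T x||^2. *)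
have V_pos x : re_inner (T x) x <= re_inner (P_T x) x.
  rewrite [leRHS]projection_norm2 // -TPT -[T (P_T x)]PTT sPT.
  have := cauchy_schwarz (T (P_T x)) (P_T x); rewrite ler_norml => /andP[_].
  have := nT (P_T x); have := nrm_ge0 (P_T x); rewrite -/P_T; nra.
have lV : linear V by exact: linear_subf.
have VE : moore_penrose (P_S \o P_T) \o (P_S \o V) = V.
  have rangeE : range (P_S \o P_T) = range S.
    apply/seteqP; split=> _ [x _ <-].
      have [w _ Tw] : range T (P_T x) by exact: projection_in.
      by exists w => //; rewrite SE Tw.
    by exists (T x) => //=; rewrite PTT SE.
  have kerE x : P_S (P_T x) = 0 -> P_T x = 0.
    have [w _ <-] : range T (P_T x) by exact: projection_in.
    by rewrite -SE => /ker_T.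
  have rangeV x : range T (V x).
    by apply: linear_subspaceB => //; exact: projection_in.
  have PTV x : P_T (V x) = V x by apply: projection_id.
  apply/funext => x /=; rewrite /moore_penrose rangeE -/P_S.
  rewrite [P_S (P_S _)]projection_id //; last exact: projection_in.
  set E := [set z | _].
  have EV : E (V x).
    split; last by rewrite /= PTV.
    move=> y /= /kerE y0; apply: inner_eq0 => c.
    by rewrite -PTV sPT linPZ // y0 scaler0 re_innerC re_inner0l.
  have [zo zE] : E (xget 0 E) by apply: (@xgetPex _ _ E); exists (V x).
  move: (xget 0 E) zo zE => z zo /= zE.
  (* The chosen z and V x have the same image and are both orthogonal to the kernel, so their
     difference is orthogonal to itself. *)
  have /kerE Pd0 : P_S (P_T (z - V x)) = 0.
    by rewrite (linPB _ lPT) (linPB _ lPS) zE PTV subrr.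
  have d0 : P_S (P_T (z - V x)) = 0 by rewrite Pd0 linP0.
  apply/eqP; rewrite -subr_eq0; apply/eqP/nrm_eq0/eqP.
  rewrite -sqrf_eq0 -re_inner_norm re_innerBl.
  have -> : re_inner (V x) (z - V x) = 0.
    by rewrite -{1}PTV sPT Pd0 re_innerC re_inner0l.
  by rewrite subr0 /re_inner zo.
have lC : linear (T \o P_S) by exact: linear_comp.
have nS1 x : nrm (S x) <= nrm x := le_trans (nS x) (nT x).
have [bB pB nB] := abs_operatorP _ _ lS lC S_adj nS1.
have [[[lU _] isoU] kerU SU] := polar_factorP _ _ lS lC S_adj nS1.
rewrite -/U in lU isoU kerU SU.
set B := abs_operator S in bB pB nB SU.
have [lB _] := bB; have [sB _] := positive_operator_re _ pB.
have isoU_T x : nrm (U (P_T x)) = nrm (P_T x).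
  apply: complexI; rewrite -!normE; apply: isoU => y; rewrite kerU => /ker_T Ty.
  apply: inner_eq0 => c; have [w _ <-] : range T (P_T x) by exact: projection_in.
  by rewrite sT linPZ // Ty scaler0 re_innerC re_inner0l.
have UPT x : U (P_T x) = U x.
  have : null_space U (x - P_T x).
    rewrite kerU; apply/ker_T; rewrite linPB // TPT subrr //.
  by rewrite /null_space /= linPB // => /eqP; rewrite subr_eq0 => /eqP.
(* U^*U = P_T, by polarizing the isometry of U on R(T). *)
have UU x y : re_inner (U x) (U y) = re_inner x (P_T y).
  have := nrmD2 (U x) (U y); rewrite -linPD // -UPT -(UPT x) -(UPT y) !isoU_T.
  rewrite (linPD _ lPT) nrmD2 UPT UPT => h.
  have -> : re_inner (U x) (U y) = re_inner (P_T x) (P_T y) by lra.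
  by rewrite sPT [P_T (P_T y)]projection_id //; exact: projection_in.
(* The adjoint form of B P_T = B, which holds because N(B) = N(S) = N(T). *)
have BT x : P_T (B x) = B x.
  apply: re_inner_ext => w; rewrite sPT !sB; congr re_inner.
  apply/eqP; rewrite -subr_eq0 -linPB //; apply/eqP/nrm_eq0.
  rewrite nB (ker_T _).1 ?nrm0 // linPB // TPT subrr //.
(* W = U (1 - B), so U^*W = P_T (1 - B). *)
have QE : adjoint U \o W = P_T \- B.
  apply/funext => x /=; apply: adjoint_eq => y.
  have -> : W x = U (x - B x) by rewrite linPB // /W /= {1}SU.
  have -> : P_T x - B x = P_T (x - B x) by rewrite linPB // BT.
  by apply: inner_eq => l; rewrite -linPZ // UU linPZ.
rewrite VE QE; apply: spectral_radius_monotone => //.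
- exact: linear_subf.
- exact: re_symmetricN.
- exact: re_symmetricN.
- by move=> x; rewrite /V /= re_innerBl subr_ge0.
- exists 2 => // x /=; apply: le_trans (nrmD _ _) _; rewrite nrmN nB.
  have := projection_le _ rT T_closed x; rewrite -/P_T; have := nS1 x; lra.
- move=> x; rewrite /V /= !re_innerBl lerD2l lerN2.
  apply: square_monotone => //; first exact/bounded_operatorP.
  by move=> y; rewrite nB.
Qed.
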